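(* Let $\mathbb{K}$ be a field and let $(X,d)$ be an object of $\mathsf{Ch}_{\mathbb{K}}^{(\mathbb{Z},\leq)}$, regarded as a differential bigraded $\mathbb{K}[t]$-module. Then there exist a differential bigraded $\mathbb{K}[t]$-module $Q$ and quasi-isomorphisms $$X\xleftarrow{\ \simeq\ }Q\xrightarrow{\ \simeq\ }H(X)$$ of differential bigraded $\mathbb{K}[t]$-modules, where $H(X)$ has the zero differential. As a consequence, $X\simeq H(X)$ in $\mathsf{Ch}_{\mathbb{K}}^{(\mathbb{Z},\leq)}$.
   Context: $\mathsf{Ch}_{\mathbb{K}}$ is the category of (not necessarily bounded) cochain complexes over $\mathbb{K}$ and $\mathsf{Ch}_{\mathbb{K}}^{(\mathbb{Z},\leq)}$ is the category of functors $(\mathbb{Z},\leq)\to\mathsf{Ch}_{\mathbb{K}}$. A differential bigraded (dbg) $\mathbb{K}[t]$-module is a cochain complex of graded $\mathbb{K}[t]$-modules ($\deg t=1$). An object $X$ of $\mathsf{Ch}_{\mathbb{K}}^{(\mathbb{Z},\leq)}$ is identified with the dbg $\mathbb{K}[t]$-module $\bigl(\bigoplus_{(i,n)\in\mathbb{Z}^2}X(i)^n,d\bigr)$, where $d:X(i)^n\to X(i)^{n+1}$ and multiplication by $t$, $X(i)^n\to X(i+1)^n$, is the structure map $X(i\to i+1)$. $H(X)=\bigoplus_{(i,n)}H^n(X(i))$. A quasi-isomorphism is a morphism inducing an isomorphism on cohomology, and $\simeq$ means connected by a zigzag of (pointwise) quasi-isomorphisms. *)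

(* Defs.v *)
From HB Require Import structures.
From mathcomp Require Import all_boot all_order all_algebra.
From mathcomp Require Import generic_quotient ring_quotient boolp.
From Stdlib Require Import Relation_Operators.

Set Implicit Arguments.
Unset Strict Implicit.
Unset Printing Implicit Defensive.

Import Order.TTheory GRing.Theory Num.Theory.
Local Open Scope ring_scope.
Local Open Scope quotient_scope.

Section QuotientModule.
Variables (R : pzRingType) (M : lmodType R) (S : {pred M}).
Hypothesis S_closed : submod_closed S.

Definition quotmod_ker : {pred M} := S.

HB.instance Definition _ := GRing.isSubmodClosed.Build R M quotmod_ker S_closed.

Definition quotmod : Type := Quotient.quot quotmod_ker.

HB.instance Definition _ := GRing.Zmodule.on quotmod.

Definition quotmod_pi (x : M) : quotmod := \pi_(Quotient.quot quotmod_ker) x.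

Lemma quotmod_piD : {morph quotmod_pi : x y / x + y}.
Proof. exact: (raddfD (\pi_(Quotient.quot quotmod_ker))). Qed.

Lemma quotmod_piP (x y : M) : quotmod_pi x = quotmod_pi y <-> x - y \in S.
Proof. by rewrite /quotmod_pi (Quotient.idealrBE quotmod_ker); split=> /eqP. Qed.

Definition quotmod_repr (x : quotmod) : M := repr (x : Quotient.quot quotmod_ker).

Lemma quotmod_reprK : cancel quotmod_repr quotmod_pi.
Proof. exact: reprK. Qed.

Definition quotmod_scale (a : R) (x : quotmod) : quotmod :=
  quotmod_pi (a *: quotmod_repr x).

Lemma quotmod_scale_pi a x : quotmod_scale a (quotmod_pi x) = quotmod_pi (a *: x).
Proof.
apply/quotmod_piP; rewrite -scalerBr.
apply: (@rpredZ R M quotmod_ker).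
by apply/quotmod_piP; rewrite quotmod_reprK.
Qed.

Fact quotmod_scalerA a b x :
  quotmod_scale a (quotmod_scale b x) = quotmod_scale (a * b) x.
Proof. by rewrite -[x]quotmod_reprK !quotmod_scale_pi scalerA. Qed.

Fact quotmod_scale1r : left_id 1 quotmod_scale.
Proof. by move=> x; rewrite -[x]quotmod_reprK quotmod_scale_pi scale1r. Qed.

Fact quotmod_scalerDr : right_distributive quotmod_scale +%R.
Proof.
move=> a x y; rewrite -[x]quotmod_reprK -[y]quotmod_reprK -quotmod_piD.
by rewrite !quotmod_scale_pi -quotmod_piD scalerDr.
Qed.

Fact quotmod_scalerDl x : {morph quotmod_scale^~ x : a b / a + b}.
Proof.
move=> a b /=; rewrite -[x]quotmod_reprK !quotmod_scale_pi -quotmod_piD.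
by rewrite scalerDl.
Qed.

HB.instance Definition _ := GRing.Zmodule_isLmodule.Build R quotmod
  quotmod_scalerA quotmod_scale1r quotmod_scalerDr quotmod_scalerDl.

Fact quotmod_pi_linear : linear quotmod_pi.
Proof. by move=> a x y; rewrite quotmod_piD -quotmod_scale_pi. Qed.

HB.instance Definition _ :=
  GRing.isLinear.Build R M quotmod _ quotmod_pi quotmod_pi_linear.

End QuotientModule.

(* The differential is indexed by both its source and target degrees together
   with a proof that they are consecutive; equality on [int] is
   proof-irrelevant, so this is one map for each degree, and it spares
   transports along equations such as [n - 1 + 1 = n]. *)
Record cochain (R : pzRingType) := Cochain {
  cobj :> int -> lmodType R;
  cdiff : forall n m : int, n + 1 = m -> {linear cobj n -> cobj m};
  cdiffK : forall (n m p : int) (nm : n + 1 = m) (mp : m + 1 = p) (x : cobj n),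
    cdiff mp (cdiff nm x) = 0
}.
Arguments cdiff {R} C {n m} nm : rename.

Record cochain_map (R : pzRingType) (C D : cochain R) := CochainMap {
  cmap :> forall n : int, {linear C n -> D n};
  cmap_diff : forall (n m : int) (nm : n + 1 = m) (x : C n),
    cmap m (cdiff C nm x) = cdiff D nm (cmap n x)
}.

Section Cohomology.
Variables (R : pzRingType) (C : cochain R) (n : int).

Definition is_cocycle : {pred C n} :=
  [pred x | cdiff C (erefl (n + 1)) x == 0].

Fact is_cocycle_submod_closed : submod_closed is_cocycle.
Proof.
split=> [|a x y]; rewrite !inE ?raddf0 //.
by move=> /eqP x0 /eqP y0; rewrite linearP x0 y0 scaler0 addr0.
Qed.

HB.instance Definition _ :=
  GRing.isSubmodClosed.Build R (C n) is_cocycle is_cocycle_submod_closed.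

Record cocycle := Cocycle { cocycle_val : C n; _ : cocycle_val \in is_cocycle }.

HB.instance Definition _ := [isSub for cocycle_val].
HB.instance Definition _ := [Choice of cocycle by <:].
HB.instance Definition _ := [SubChoice_isSubLmodule of cocycle by <:].

Definition is_coboundary : {pred cocycle} :=
  [pred x : cocycle |
    `[< exists y : C (n - 1), cdiff C (subrK 1 n) y = cocycle_val x >]].

Fact is_coboundary_submod_closed : submod_closed is_coboundary.
Proof.
split=> [|a x y]; rewrite !inE.
  by apply/asboolP; exists 0; rewrite raddf0.
move=> /asboolP[x' x'E] /asboolP[y' y'E].
by apply/asboolP; exists (a *: x' + y'); rewrite linearP x'E y'E.
Qed.

Definition cohomology : lmodType R := quotmod is_coboundary_submod_closed.

Definition coclass (x : cocycle) : cohomology :=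
  quotmod_pi is_coboundary_submod_closed x.

Lemma coclass_surj (x : cohomology) : exists y : cocycle, x = coclass y.
Proof. by exists (quotmod_repr x); rewrite /coclass quotmod_reprK. Qed.

Lemma coclassP (x y : cocycle) : coclass x = coclass y <->
  exists z : C (n - 1), cdiff C (subrK 1 n) z = cocycle_val x - cocycle_val y.
Proof.
split=> [/quotmod_piP|xy]; first by rewrite inE => /asboolP.
by apply/quotmod_piP; rewrite inE; apply/asboolP.
Qed.

End Cohomology.

Section CohomologyMap.
Variables (R : pzRingType) (C D : cochain R) (f : cochain_map C D) (n : int).

Fact cocycle_map_subproof (x : cocycle C n) :
  f n (cocycle_val x) \in @is_cocycle R D n.
Proof. by case: x => x /= /eqP xZ; rewrite inE -cmap_diff xZ raddf0. Qed.

Definition cocycle_map (x : cocycle C n) : cocycle D n :=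
  Cocycle (cocycle_map_subproof x).

Definition cohomology_map_fun (x : cohomology C n) : cohomology D n :=
  coclass (cocycle_map (quotmod_repr x)).

Lemma cohomology_map_class (x : cocycle C n) :
  cohomology_map_fun (coclass x) = coclass (cocycle_map x).
Proof.
apply/quotmod_piP.
have : quotmod_repr (coclass x) - x \in @is_coboundary R C n.
  by apply/(quotmod_piP (@is_coboundary_submod_closed R C n)); exact: quotmod_reprK.
rewrite !inE => /asboolP[y yE]; apply/asboolP; exists (f _ y).
by rewrite -cmap_diff yE /= raddfB.
Qed.

Fact cohomology_map_linear : linear cohomology_map_fun.
Proof.
move=> a x y; rewrite -[x]quotmod_reprK -[y]quotmod_reprK -linearP.
rewrite !cohomology_map_class /coclass -linearP; congr (quotmod_pi _ _).
by apply/val_inj; rewrite /= linearP.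
Qed.

HB.instance Definition _ := GRing.isLinear.Build R (cohomology C n)
  (cohomology D n) _ cohomology_map_fun cohomology_map_linear.

Definition cohomology_map : {linear cohomology C n -> cohomology D n} :=
  cohomology_map_fun.

End CohomologyMap.

Definition quasi_iso (R : pzRingType) (C D : cochain R) (f : cochain_map C D) :=
  forall n : int, bijective (cohomology_map f n).

Record Zcochain (R : pzRingType) := ZCochain {
  zobj :> int -> cochain R;
  zmap : forall i j : int, i <= j -> cochain_map (zobj i) (zobj j);
  zmap_id : forall (i : int) (ii : i <= i) (n : int) (x : zobj i n),
    zmap ii n x = x;
  zmap_comp : forall (i j k : int) (ij : i <= j) (jk : j <= k) (ik : i <= k)
    (n : int) (x : zobj i n), zmap ik n x = zmap jk n (zmap ij n x)
}.
Arguments zmap {R} X {i j} ij : rename.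

Record Zcochain_map (R : pzRingType) (X Y : Zcochain R) := ZCochainMap {
  ztrans :> forall i : int, cochain_map (X i) (Y i);
  ztrans_nat : forall (i j : int) (ij : i <= j) (n : int) (x : X i n),
    ztrans j n (zmap X ij n x) = zmap Y ij n (ztrans i n x)
}.

Definition Zquasi_iso (R : pzRingType) (X Y : Zcochain R)
    (f : Zcochain_map X Y) := forall i : int, quasi_iso (f i).

(* Connected by a zigzag of pointwise quasi-isomorphisms. *)
Definition Zweq (R : pzRingType) : Zcochain R -> Zcochain R -> Prop :=
  clos_refl_sym_trans (Zcochain R)
    (fun X Y => exists f : Zcochain_map X Y, Zquasi_iso f).

Section ZCohomology.
Variables (R : pzRingType).

Section ZeroDifferential.
Variable V : int -> lmodType R.

Definition zero_cochain_diff (n m : int) (_ : n + 1 = m) : {linear V n -> V m} :=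
  \0.

Fact zero_cochain_diffK (n m p : int) (nm : n + 1 = m) (mp : m + 1 = p) (x : V n) :
  zero_cochain_diff mp (zero_cochain_diff nm x) = 0.
Proof. by []. Qed.

Definition zero_cochain : cochain R := Cochain zero_cochain_diffK.
End ZeroDifferential.

Variable X : Zcochain R.

Definition Zcohomology_obj (i : int) : cochain R :=
  zero_cochain (cohomology (X i)).

Fact Zcohomology_map_diff (i j : int) (ij : i <= j) (n m : int)
    (nm : n + 1 = m) (x : Zcohomology_obj i n) :
  cohomology_map (zmap X ij) m (cdiff (Zcohomology_obj i) nm x) =
  cdiff (Zcohomology_obj j) nm (cohomology_map (zmap X ij) n x).
Proof. by rewrite /= raddf0. Qed.

Definition Zcohomology_map (i j : int) (ij : i <= j) :
    cochain_map (Zcohomology_obj i) (Zcohomology_obj j) :=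
  @CochainMap R (Zcohomology_obj i) (Zcohomology_obj j)
    (cohomology_map (zmap X ij)) (Zcohomology_map_diff ij).

Fact Zcohomology_map_id (i : int) (ii : i <= i) (n : int)
    (x : Zcohomology_obj i n) : Zcohomology_map ii n x = x.
Proof.
rewrite -[x]quotmod_reprK /= cohomology_map_class; congr (quotmod_pi _ _).
by apply/val_inj; rewrite /= zmap_id.
Qed.

Fact Zcohomology_map_comp (i j k : int) (ij : i <= j) (jk : j <= k)
    (ik : i <= k) (n : int) (x : Zcohomology_obj i n) :
  Zcohomology_map ik n x = Zcohomology_map jk n (Zcohomology_map ij n x).
Proof.
have [y ->] := coclass_surj x.
rewrite [LHS]cohomology_map_class [Zcohomology_map ij n _]cohomology_map_class.
rewrite [RHS]cohomology_map_class; congr (quotmod_pi _ _).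
by apply/val_inj; rewrite /= (zmap_comp ij jk).
Qed.

(* [i |-> H (X i)], each [H (X i)] carrying the zero differential. *)
Definition Zcohomology : Zcochain R :=
  ZCochain Zcohomology_map_id Zcohomology_map_comp.

End ZCohomology.

(* A grading of a K[t]-module, where [t] has degree 1 and hence the homogeneous
   elements of degree [k] of K[t] are the [c *: 'X^k]. *)
Record grading (K : fieldType) (M : lmodType {poly K}) := Grading {
  gcomp : int -> M -> Prop;
  gcomp0 : forall i, gcomp i 0;
  gcompB : forall i x y, gcomp i x -> gcomp i y -> gcomp i (x - y);
  gcompZ : forall i x (c : K) (k : nat),
    gcomp i x -> gcomp (i + k%:Z) ((c *: 'X^k) *: x);
  gcomp_gen : forall x, exists (s : seq int) (y : int -> M),
    (forall i, gcomp i (y i)) /\ x = \sum_(i <- s) y i;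
  gcomp_indep : forall (s : seq int) (y : int -> M), uniq s ->
    (forall i, gcomp i (y i)) -> \sum_(i <- s) y i = 0 ->
    forall i, i \in s -> y i = 0
}.

(* The cohomological degree is the index of the complex, the internal degree
   is that of the grading. *)
Record dbgmod (K : fieldType) := DbgMod {
  dbg_cochain :> cochain {poly K};
  dbg_grading : forall n : int, grading (dbg_cochain n);
  dbg_diff_comp : forall (n m : int) (nm : n + 1 = m) (i : int)
    (x : dbg_cochain n), gcomp (dbg_grading n) i x ->
    gcomp (dbg_grading m) i (cdiff dbg_cochain nm x)
}.

Record dbg_map (K : fieldType) (P Q : dbgmod K) := DbgMap {
  dbg_cochain_map :> cochain_map P Q;
  dbg_map_comp : forall (n i : int) (x : P n), gcomp (dbg_grading P n) i x ->
    gcomp (dbg_grading Q n) i (dbg_cochain_map n x)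
}.

Definition dbg_quasi_iso (K : fieldType) (P Q : dbgmod K) (f : dbg_map P Q) :=
  quasi_iso (dbg_cochain_map f).

Section DirectProduct.
Variables (K : pzRingType) (I : choiceType) (V : I -> lmodType K).

Definition dprod : Type := forall i, V i.

HB.instance Definition _ := gen_eqMixin dprod.
HB.instance Definition _ := gen_choiceMixin dprod.

Let dprod_add (f g : dprod) : dprod := fun i => f i + g i.
Let dprod_opp (f : dprod) : dprod := fun i => - f i.
Let dprod_zero : dprod := fun=> 0.
Let dprod_scale (a : K) (f : dprod) : dprod := fun i => a *: f i.

Fact dprod_addA : associative dprod_add.
Proof. by move=> f g h; apply: functional_extensionality_dep => i; exact: addrA. Qed.
Fact dprod_addC : commutative dprod_add.
Proof. by move=> f g; apply: functional_extensionality_dep => i; exact: addrC. Qed.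
Fact dprod_add0 : left_id dprod_zero dprod_add.
Proof. by move=> f; apply: functional_extensionality_dep => i; exact: add0r. Qed.
Fact dprod_addN : left_inverse dprod_zero dprod_opp dprod_add.
Proof. by move=> f; apply: functional_extensionality_dep => i; exact: addNr. Qed.

HB.instance Definition _ :=
  GRing.isZmodule.Build dprod dprod_addA dprod_addC dprod_add0 dprod_addN.

Fact dprod_scaleA a b f : dprod_scale a (dprod_scale b f) = dprod_scale (a * b) f.
Proof. by apply: functional_extensionality_dep => i; exact: scalerA. Qed.
Fact dprod_scale1 : left_id 1 dprod_scale.
Proof. by move=> f; apply: functional_extensionality_dep => i; exact: scale1r. Qed.
Fact dprod_scaleDr : right_distributive dprod_scale +%R.
Proof. by move=> a f g; apply: functional_extensionality_dep => i; exact: scalerDr. Qed.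
Fact dprod_scaleDl f : {morph dprod_scale^~ f : a b / a + b}.
Proof. by move=> a b; apply: functional_extensionality_dep => i; exact: scalerDl. Qed.

HB.instance Definition _ := GRing.Zmodule_isLmodule.Build K dprod
  dprod_scaleA dprod_scale1 dprod_scaleDr dprod_scaleDl.

Definition finite_supp : {pred dprod} :=
  [pred f : dprod |
    `[< exists s : seq I, forall i, i \notin s -> f i = 0 >]].

Fact finite_supp_submod_closed : submod_closed finite_supp.
Proof.
split=> [|a f g]; rewrite !inE; first by apply/asboolP; exists [::].
move=> /asboolP[s fs] /asboolP[s' gs']; apply/asboolP; exists (s ++ s') => i.
rewrite mem_cat negb_or => /andP[/fs fi /gs' gi].
by transitivity (a *: f i + g i); last rewrite fi gi scaler0 addr0.
Qed.

HB.instance Definition _ :=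
  GRing.isSubmodClosed.Build K dprod finite_supp finite_supp_submod_closed.

Record dsum := DSum { dsum_val : dprod; _ : dsum_val \in finite_supp }.

HB.instance Definition _ := [isSub for dsum_val].
HB.instance Definition _ := [Choice of dsum by <:].
HB.instance Definition _ := [SubChoice_isSubLmodule of dsum by <:].

Definition dsum_coef (i : I) (f : dsum) : V i := dsum_val f i.

Lemma dsumP (f g : dsum) : (forall i, dsum_coef i f = dsum_coef i g) -> f = g.
Proof. by move=> fg; apply/val_inj/functional_extensionality_dep. Qed.

Lemma dsum_supp (f : dsum) :
  exists s : seq I, forall i, i \notin s -> dsum_coef i f = 0.
Proof. by case: f => f /=; rewrite inE => /asboolP. Qed.

Fact dsum_coef_linear i : linear (dsum_coef i).
Proof. by []. Qed.

HB.instance Definition _ i :=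
  GRing.isLinear.Build K dsum (V i) _ (dsum_coef i) (dsum_coef_linear i).

Definition mk_dsum (f : dprod)
  (fP : exists s : seq I, forall i, i \notin s -> f i = 0) : dsum :=
  @DSum f (introT (asboolP _) fP).

End DirectProduct.

(* [phi] is what the action of ['X] on this copy of [V] is defined from. *)
Definition polymod (K : fieldType) (V : lmodType K) (phi : {linear V -> V}) :
  Type := V.
Arguments polymod {K V} phi.

Section PolyModule.
Variables (K : fieldType) (V : lmodType K) (phi : {linear V -> V}).

HB.instance Definition _ := GRing.Zmodule.on (polymod phi).

Definition poly_act (p : {poly K}) (v : polymod phi) : polymod phi :=
  \sum_(k < size p) (p`_k *: iter k phi (v : V)).

Lemma poly_act_wide N (p : {poly K}) v : (size p <= N)%N ->
  poly_act p v = \sum_(k < N) (p`_k *: iter k phi (v : V)).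
Proof.
move=> leN; rewrite /poly_act (big_ord_widen N (fun k => p`_k *: iter k phi v)) //.
rewrite big_mkcond; apply: eq_bigr => k _; case: ltnP => // leNk.
by rewrite nth_default // scale0r.
Qed.

Fact poly_actDl v : {morph poly_act^~ v : p q / p + q}.
Proof.
move=> p q /=; set N := maxn (size p) (size q).
rewrite !(@poly_act_wide N) ?leq_maxl ?leq_maxr ?size_polyD //.
by rewrite -big_split; apply: eq_bigr => k _; rewrite coefD scalerDl.
Qed.

Fact poly_actDr : right_distributive poly_act +%R.
Proof.
move=> p u v; rewrite /poly_act -big_split; apply: eq_bigr => k _ /=.
by rewrite -scalerDr; congr (_ *: _); elim: (k : nat) => //= m ->; rewrite raddfD.
Qed.

Lemma poly_actC c v : poly_act c%:P v = c *: (v : V).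
Proof.
by rewrite (@poly_act_wide 1) ?size_polyC_leq1 // big_ord1 coefC.
Qed.

Lemma poly_actZ c p v : poly_act (c%:P * p) v = c *: (poly_act p v : V).
Proof.
rewrite mul_polyC (@poly_act_wide (size p)) ?size_scale_leq //.
by rewrite /poly_act scaler_sumr; apply: eq_bigr => k _; rewrite coefZ scalerA.
Qed.

Lemma poly_actX p v : poly_act ('X * p) v = phi (poly_act p v).
Proof.
rewrite (@poly_act_wide (size p).+1); last first.
  by rewrite (leq_trans (size_polyMleq _ _)) // size_polyX.
rewrite big_ord_recl coefXM scale0r add0r /poly_act raddf_sum.
by apply: eq_bigr => k _; rewrite coefXM /= linearZ.
Qed.

Fact poly_actA p q v : poly_act p (poly_act q v) = poly_act (p * q) v.
Proof.
elim/poly_ind: p => [|p c IHp] in q v *.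
  by rewrite mul0r /poly_act size_poly0 !big_ord0.
rewrite commr_polyX mulrDl -mulrA [LHS]poly_actDl [RHS]poly_actDl.
by rewrite poly_actC poly_actZ !poly_actX IHp.
Qed.

Fact poly_act1 : left_id 1 poly_act.
Proof. by move=> v; rewrite poly_actC scale1r. Qed.

HB.instance Definition _ := GRing.Zmodule_isLmodule.Build {poly K} (polymod phi)
  poly_actA poly_act1 poly_actDr poly_actDl.

End PolyModule.

Section PolyModuleMap.
Variables (K : fieldType) (V W : lmodType K).
Variables (phi : {linear V -> V}) (psi : {linear W -> W}) (f : {linear V -> W}).
Hypothesis f_comm : forall v, f (phi v) = psi (f v).

Definition polymod_map_fun (v : polymod phi) : polymod psi := f v.

Fact polymod_map_linear : linear polymod_map_fun.
Proof.
move=> p u v; rewrite /polymod_map_fun raddfD; congr (_ + _).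
rewrite [LHS]raddf_sum; apply: eq_bigr => k _; rewrite [LHS]linearZ_LR.
have -> // : f (iter k phi (u : V)) = iter k psi (f u).
by elim: (k : nat) => //= m <-.
Qed.

HB.instance Definition _ := GRing.isLinear.Build {poly K} (polymod phi)
  (polymod psi) _ polymod_map_fun polymod_map_linear.

Definition polymod_map : {linear polymod phi -> polymod psi} := polymod_map_fun.

End PolyModuleMap.

Section DbgOfZcochain.
Variables (K : fieldType) (X : Zcochain K).

Definition total_obj (n : int) : lmodType K := dsum (fun i : int => X i n).

Section Shift.
Variable n : int.

Fact pred_le (i : int) : i - 1 <= i.
Proof. by rewrite gerBl. Qed.

Fact shift_subproof (f : total_obj n) : exists s : seq int,
  forall i, i \notin s -> zmap X (pred_le i) n (dsum_coef (i - 1) f) = 0.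
Proof.
have [s fs] := dsum_supp f; exists [seq i + 1 | i <- s] => i si.
rewrite fs ?raddf0 //; apply: contra si => si.
by apply/mapP; exists (i - 1); rewrite ?subrK.
Qed.

Definition shift_fun (f : total_obj n) : total_obj n :=
  mk_dsum (shift_subproof f).

Fact shift_linear : linear shift_fun.
Proof.
move=> a f g; apply: dsumP => i.
exact: (linearP (zmap X (pred_le i) n) a (dsum_coef _ f) (dsum_coef _ g)).
Qed.

HB.instance Definition _ :=
  GRing.isLinear.Build K (total_obj n) (total_obj n) _ shift_fun shift_linear.

Definition shift : {linear total_obj n -> total_obj n} := shift_fun.

Definition dbg_obj : lmodType {poly K} := polymod shift.

Lemma dbg_obj_X (f : dbg_obj) (i : int) :
  dsum_coef i ('X *: f : total_obj n) =
  zmap X (pred_le i) n (dsum_coef (i - 1) (f : total_obj n)).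
Proof.
have -> // : 'X *: f = shift (f : total_obj n) :> total_obj n.
by rewrite -['X]mulr1 [LHS]poly_actX; congr (shift _); exact: poly_act1.
Qed.

Definition dbg_obj_comp (i : int) (f : dbg_obj) : Prop :=
  forall j, j != i -> dsum_coef j (f : total_obj n) = 0.

End Shift.

Section Differential.
Variables (n m : int) (nm : n + 1 = m).

Fact total_diff_subproof (f : total_obj n) : exists s : seq int,
  forall i, i \notin s -> cdiff (X i) nm (dsum_coef i f) = 0.
Proof. by have [s fs] := dsum_supp f; exists s => i /fs ->; rewrite raddf0. Qed.

Definition total_diff_fun (f : total_obj n) : total_obj m :=
  mk_dsum (total_diff_subproof f).

Fact total_diff_linear : linear total_diff_fun.
Proof.
move=> a f g; apply: dsumP => i.
exact: (linearP (cdiff (X i) nm) a (dsum_coef _ f) (dsum_coef _ g)).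
Qed.

HB.instance Definition _ := GRing.isLinear.Build K (total_obj n) (total_obj m) _
  total_diff_fun total_diff_linear.

Definition total_diff : {linear total_obj n -> total_obj m} := total_diff_fun.

Fact total_diff_shift f : total_diff (shift n f) = shift m (total_diff f).
Proof. by apply: dsumP => i; rewrite [RHS]cmap_diff. Qed.

Definition dbg_diff : {linear dbg_obj n -> dbg_obj m} :=
  polymod_map total_diff_shift.

End Differential.

Fact dbg_diffK (n m p : int) (nm : n + 1 = m) (mp : m + 1 = p) (x : dbg_obj n) :
  dbg_diff mp (dbg_diff nm x) = 0.
Proof. by apply: (@dsumP _ _ _ _ 0) => i; exact: cdiffK. Qed.

Definition dbg_of_cochain : cochain {poly K} := Cochain dbg_diffK.

Section Grading.
Variable n : int.
Local Notation M := (dbg_obj n).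
Local Notation coef i := (fun f : M => dsum_coef i (f : total_obj n)).

Fact dbg_comp0 i : dbg_obj_comp i (0 : M).
Proof. by []. Qed.

Fact dbg_compB i (x y : M) :
  dbg_obj_comp i x -> dbg_obj_comp i y -> dbg_obj_comp i (x - y).
Proof.
move=> xi yi j ji.
transitivity (dsum_coef j (x : total_obj n) - dsum_coef j (y : total_obj n)) => //.
by rewrite (xi _ ji) (yi _ ji) subr0.
Qed.

Fact dbg_compZ i (x : M) (c : K) (k : nat) :
  dbg_obj_comp i x -> dbg_obj_comp (i + k%:Z) ((c *: 'X^k) *: x).
Proof.
move=> xi.
have -> : (c *: 'X^k) *: x = c *: (iter k (shift n) (x : total_obj n)).
  rewrite -mul_polyC; elim: k => [|k IHk].
    by rewrite expr0 mulr1 [LHS]poly_actC.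
  by rewrite exprS mulrCA [LHS]poly_actX [poly_act _ _]IHk linearZ.
have kP : forall j, j != i + k%:Z -> 
    dsum_coef j (iter k (shift n) (x : total_obj n)) = 0.
  elim: k => [|k IHk] j; first by rewrite addr0 => /xi.
  move=> ji; transitivity (zmap X (pred_le j) n
    (dsum_coef (j - 1) (iter k (shift n) (x : total_obj n)))) => //.
  rewrite IHk ?raddf0 //; apply: contraNneq ji => jE; apply/eqP.
  by rewrite -[j](subrK 1) jE -addrA -[_ + 1%:Z]PoszD addn1.
move=> j /kP xj; transitivity (c *: dsum_coef j (iter k (shift n) (x : total_obj n))) => //.
by rewrite xj scaler0.
Qed.

Fact sum_coef (s : seq int) (y : int -> M) j :
  coef j (\sum_(i <- s) y i) = \sum_(i <- s) coef j (y i).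
Proof. exact: (raddf_sum (dsum_coef j)). Qed.

Fact dbg_comp_gen (x : M) : exists (s : seq int) (y : int -> M),
  (forall i, dbg_obj_comp i (y i)) /\ x = \sum_(i <- s) y i.
Proof.
have [s xs] := dsum_supp (x : total_obj n).
have yP i : exists s : seq int,
    forall j, j \notin s -> (if j == i then coef j x else 0) = 0.
  by exists [:: i] => j; rewrite inE => /negPf ->.
exists (undup s), (fun i => mk_dsum (yP i)); split=> [i j /negPf|].
  by rewrite /dsum_coef /= => ->.
apply: dsumP => j; rewrite [RHS]sum_coef.
have [js|/[dup] js /xs ->] := boolP (j \in s).
  rewrite (bigD1_seq j) ?mem_undup ?undup_uniq //= big1 => [|i /negPf ij].
    by rewrite addr0 /dsum_coef /= eqxx.
  by rewrite /dsum_coef /= eq_sym ij.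
rewrite big_seq big1 // => i; rewrite mem_undup => si.
by rewrite /dsum_coef /=; case: eqP => // ji; rewrite -ji (negPf js) in si.
Qed.

Fact dbg_comp_indep (s : seq int) (y : int -> M) : uniq s ->
  (forall i, dbg_obj_comp i (y i)) -> \sum_(i <- s) y i = 0 ->
  forall i, i \in s -> y i = 0.
Proof.
move=> s_uniq yi y0 i si; apply: (@dsumP _ _ _ _ 0) => j.
have [->|/yi -> //] := eqVneq j i.
have := congr1 (coef i) y0; rewrite sum_coef (bigD1_seq i) //= big1 ?addr0 //.
by move=> k ki; apply: yi; rewrite eq_sym.
Qed.

Definition dbg_of_grading : grading M :=
  Grading dbg_comp0 dbg_compB dbg_compZ dbg_comp_gen dbg_comp_indep.

End Grading.

Fact dbg_of_diff_comp (n m : int) (nm : n + 1 = m) (i : int)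
    (x : dbg_of_cochain n) : gcomp (dbg_of_grading n) i x ->
  gcomp (dbg_of_grading m) i (cdiff dbg_of_cochain nm x).
Proof.
move=> xi j ji.
transitivity (cdiff (X j) nm (dsum_coef j (x : total_obj n))) => //.
by rewrite (xi _ ji) raddf0.
Qed.

Definition dbg_of : dbgmod K :=
  @DbgMod K dbg_of_cochain dbg_of_grading dbg_of_diff_comp.

End DbgOfZcochain.

(* Main.v *)
(* The idea is to replace [H (X)] by a free resolution.  Over [K[t]], the functor
   [M = H (X)] has the free resolution 0 -> F1 -> F0 -> M -> 0 with
   F0 (i) the direct sum of the [M j] for [j <= i] and F1 (i) that of the [M j]
   for [j < i], where [h] in the [j]-th summand of F1 goes to [t h] in the
   [j + 1]-st summand of F0 minus [h] in the [j]-th one.  Let Q be the complex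
   with Q^n = F0^n + F1^(n+1); it projects onto [M] by a quasi-isomorphism.
   As K is a field, cohomology classes have linear representatives [sigma],
   and [sigma (t h) - t (sigma h)] is the differential of some [tau h] that is
   linear in [h]; since F0 and F1 are free, [sigma] and [tau] assemble into a
   morphism Q -> X, which induces on cohomology the same map as Q -> M.  Taking
   direct sums turns both morphisms into morphisms of dbg K[t]-modules. *)

Require Import Defs.
From HB Require Import structures.
From mathcomp Require Import all_boot all_order all_algebra.
From mathcomp Require Import zify.
From mathcomp Require Import boolp classical_sets.
From Stdlib Require Import Relation_Operators.

Set Implicit Arguments.
Unset Strict Implicit.
Unset Printing Implicit Defensive.

Import Order.TTheory GRing.Theory Num.Theory.
Local Open Scope ring_scope.

(** * Linear algebra over a field: complements of kernels and linear lifts *)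

Section LinearLift.
Variables (K : fieldType) (V W : lmodType K) (f : {linear V -> W}).

(* A subspace maximal among those meeting the kernel of [f] trivially is a
   complement of that kernel. *)
Lemma linear_complement : exists S : V -> Prop,
  [/\ forall a x y, S x -> S y -> S (a *: x + y),
      forall x, S x -> f x = 0 -> x = 0 &
      forall v, exists2 s, S s & f s = f v].
Proof.
pose P : set (set V) := fun S =>
  (forall a x y, S x -> S y -> S (a *: x + y)) /\
  (forall x, S x -> f x = 0 -> x = 0).
have [F FP Ftot|S [[SD S0] Smax]] := @Zorn_bigcup V P.
  split=> [a x y [A FA Ax] [B FB By]|x [A FA Ax]]; last exact: (FP _ FA).2.
  have [AB|BA] := Ftot _ _ FA FB.
    by exists B => //; apply: (FP _ FB).1 => //; exact: AB.
  by exists A => //; apply: (FP _ FA).1 => //; exact: BA.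
(* [P] holds vacuously for the empty set. If 0 were missing, [S] would be empty, since [x] in [S]
   gives [- x + x] in [S], and then {0} would be strictly larger. *)
have S0' : S 0.
  apply: contrapT => nS0; apply: (Smax [set 0]%classic).
    split=> [x Sx|/(_ 0 erefl)//].
    by case: nS0; rewrite -(addNr x) -scaleN1r; exact: SD.
  by split=> [a x y -> ->|x -> //]; rewrite scaler0 addr0.
exists S; split=> // v; apply: contrapT => nv.
(* [B] is the span of [v] and [S]. It still meets the kernel trivially: a kernel element
   [a *: v + s] with [a] nonzero would make [- a^-1 *: s] an element of [S] with the same image as
   [v]. *)
pose B : set V := fun x => exists a, exists2 s, S s & x = a *: v + s.
apply: (Smax B).
  split=> [x Sx|BS]; first by exists 0, x; rewrite ?scale0r ?add0r.
  apply: nv; exists v => //; apply: BS; exists 1, 0 => //.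
  by rewrite scale1r addr0.
split=> [a _ _ [b [x Sx ->]] [c [y Sy ->]]|_ [a [s Ss ->]] fas].
  exists (a * b + c), (a *: x + y); first exact: SD.
  by rewrite scalerDr scalerA scalerDl addrACA.
have [a0|a0] := eqVneq a 0.
  by move: fas; rewrite a0 scale0r add0r => /(S0 _ Ss).
case: nv; exists (- a^-1 *: s); first by rewrite -[_ *: s]addr0; exact: SD.
apply: (scalerI a0); rewrite linearZ scalerA mulrN divff // scaleN1r.
by apply/eqP; rewrite eq_sym -addr_eq0 -linearZ -linearD fas.
Qed.

(** Choose [h u] inside a complement of the kernel of [f]. There [f] is injective, so the choice is
    unique and therefore linear. *)
Lemma linear_lift (U : lmodType K) (g : {linear U -> W}) :
  (forall u, exists v, f v = g u) ->
  exists h : {linear U -> V}, forall u, f (h u) = g u.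
Proof.
move=> fg; have [S [SD S0 fS]] := linear_complement.
have hP u : exists v, S v /\ f v = g u.
  by have [v <-] := fg u; have [s Ss <-] := fS v; exists s.
pose h u := projT1 (cid (hP u)).
have Sh u : S (h u) by rewrite /h; case: cid => v [].
have fh u : f (h u) = g u by rewrite /h; case: cid => v [].
have Suniq x y : S x -> S y -> f x = f y -> x = y.
  move=> Sx Sy fxy; apply/eqP; rewrite -subr_eq0; apply/eqP/S0.
    by rewrite addrC -scaleN1r; exact: SD.
  by rewrite linearB fxy subrr.
have h_lin : linear h.
  by move=> a u v; apply: Suniq => //; [exact: SD | rewrite linearP !fh linearP].
pose hL := GRing.isLinear.Build K U V *:%R h h_lin.
by exists (HB.pack_for {linear U -> V} h hL).
Qed.

End LinearLift.

(** * Constructing elements of direct sums and linear maps out of them *)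

Section DirectSum.
Variables (K : pzRingType) (I : choiceType) (V : I -> lmodType K).

(** Taking the value 0 outside [s] keeps the componentwise choices finitely supported. *)
Lemma dsum_choice (P : forall i, V i -> Prop) (s : seq I) :
  (forall i, exists v, P i v) -> (forall i, i \notin s -> P i 0) ->
  exists f : dsum V, forall i, P i (dsum_coef i f).
Proof.
move=> PV Ps.
pose v i : V i := if i \in s then projT1 (cid (PV i)) else 0.
have vs : exists s : seq I, forall i, i \notin s -> v i = 0.
  by exists s => i /negPf si; rewrite /v si.
exists (mk_dsum vs) => i; rewrite /dsum_coef /= /v.
by case: ifPn => [_|/Ps //]; case: cid.
Qed.

Section Lift.
Variables (W : lmodType K) (phi : forall i, {linear V i -> W}).

Definition dsum_lift_fun (f : dsum V) : W :=
  \sum_(i <- undup (projT1 (cid (dsum_supp f)))) phi i (dsum_coef i f).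

(** The sum does not depend on the chosen support: any two lists agree, up to order, after filtering
    out the indices with zero coefficient. *)
Lemma dsum_lift_funE (s : seq I) (f : dsum V) :
  uniq s -> (forall i, i \notin s -> dsum_coef i f = 0) ->
  dsum_lift_fun f = \sum_(i <- s) phi i (dsum_coef i f).
Proof.
have nzE (r : seq I) : \sum_(i <- r) phi i (dsum_coef i f) =
    \sum_(i <- [seq i <- r | dsum_coef i f != 0]) phi i (dsum_coef i f).
  rewrite big_filter [RHS]big_mkcond; apply: eq_bigr => i _.
  by case: eqP => // ->; rewrite raddf0.
move=> s_uniq fs; rewrite /dsum_lift_fun; case: cid => r fr /=.
rewrite nzE [RHS]nzE; apply: perm_big; apply: uniq_perm.
- exact: filter_uniq (undup_uniq r).
- exact: filter_uniq.
move=> i; rewrite !mem_filter mem_undup; case: eqP => //= fi.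
by rewrite (contra_notT (@fr i)) // (contra_notT (@fs i)).
Qed.

Fact dsum_lift_linear : linear dsum_lift_fun.
Proof.
move=> a f g; have [[s fs] [r gr]] := (dsum_supp f, dsum_supp g).
have sr i : i \notin undup (s ++ r) -> dsum_coef i f = 0 /\ dsum_coef i g = 0.
  by rewrite mem_undup mem_cat negb_or => /andP[/fs -> /gr ->].
rewrite !(@dsum_lift_funE (undup (s ++ r))) ?undup_uniq //.
- rewrite scaler_sumr -big_split; apply: eq_bigr => i _ /=.
  by rewrite !linearP.
- by move=> i /sr[].
- by move=> i /sr[].
- by move=> i /sr[fi gi]; rewrite linearP /= fi gi scaler0 addr0.
Qed.

HB.instance Definition _ :=
  GRing.isLinear.Build K (dsum V) W _ dsum_lift_fun dsum_lift_linear.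

Definition dsum_lift : {linear dsum V -> W} := dsum_lift_fun.

Lemma dsum_liftE (s : seq I) (f : dsum V) :
  uniq s -> (forall i, i \notin s -> dsum_coef i f = 0) ->
  dsum_lift f = \sum_(i <- s) phi i (dsum_coef i f).
Proof. exact: dsum_lift_funE. Qed.

End Lift.
End DirectSum.

(** * Cohomology classes handled through representatives *)

Section Represents.
Variables (R : pzRingType) (C : cochain R) (n : int).

(** A relation rather than a function: the cocycle condition is carried inside it, so
    representatives can be added and mapped as plain elements of [C n]. *)
Definition represents (x : C n) (h : cohomology C n) : Prop :=
  exists2 y : cocycle C n, cocycle_val y = x & coclass y = h.

Lemma represents0 : represents 0 0.
Proof. by exists 0 => //; exact: raddf0. Qed.

Lemma representsD x y h k :
  represents x h -> represents y k -> represents (x + y) (h + k).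
Proof.
by move=> [x' <- <-] [y' <- <-]; exists (x' + y') => //; exact: raddfD.
Qed.

Lemma represents_ex (h : cohomology C n) : exists x, represents x h.
Proof. by have [y ->] := coclass_surj h; exists (cocycle_val y), y. Qed.

Lemma cocycle_represents (x : C n) :
  cdiff C (erefl (n + 1)) x = 0 -> exists h, represents x h.
Proof.
move=> dx; have xZ : x \in @is_cocycle R C n by rewrite inE dx.
by exists (coclass (Cocycle xZ)), (Cocycle xZ).
Qed.

Lemma represents_cocycle (m : int) (nm : n + 1 = m) (x : C n) h :
  represents x h -> cdiff C nm x = 0.
Proof. by case: m / nm => -[[y /= yZ] <- _]; apply/eqP. Qed.

(** Frees coboundaries from the particular source degree [n - 1]; this works because equality proofs
    on [int] are irrelevant. *)
Lemma is_coboundaryP (m : int) (mn : m + 1 = n) (x : C n) :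
  (exists z, cdiff C mn z = x) <-> exists z, cdiff C (subrK 1 n) z = x.
Proof.
have mE : n - 1 = m by rewrite -mn addrK.
by case: m / mE mn => mn; rewrite (eq_irrelevance mn (subrK 1 n)).
Qed.

Lemma represents_eq (m : int) (mn : m + 1 = n) (x y : C n) h :
  represents x h -> represents y h -> exists z, cdiff C mn z = x - y.
Proof.
by move=> [x' <- <-] [y' <- /esym/coclassP xy]; apply/is_coboundaryP.
Qed.

Lemma represents_eq0 (m : int) (mn : m + 1 = n) (x : C n) h :
  represents x h -> (exists z, cdiff C mn z = x) <-> h = 0.
Proof.
move=> xh; split=> [|h0]; last first.
  have := represents_eq mn xh; rewrite h0 => /(_ _ represents0).
  by rewrite subr0.
rewrite is_coboundaryP; case: xh => [x' <- <-] xB.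
rewrite -[0](raddf0 (quotmod_pi (@is_coboundary_submod_closed R C n))).
by apply/coclassP; rewrite /= subr0.
Qed.

Lemma represents_diff (m : int) (mn : m + 1 = n) (z : C m) :
  represents (cdiff C mn z) 0.
Proof.
have [h zh] := cocycle_represents (cdiffK mn (erefl (n + 1)) z).
by have [<- //] := represents_eq0 mn zh; exists z.
Qed.

Lemma represents_fun (x : C n) h k : represents x h -> represents x k -> h = k.
Proof.
by move=> [x' x'E <-] [y' y'E <-]; congr coclass; apply/val_inj; rewrite /= x'E.
Qed.

End Represents.

Section QuasiIso.
Variables (R : pzRingType) (C D : cochain R) (f : cochain_map C D).

Lemma represents_map n (x : C n) h :
  represents x h -> represents (f n x) (cohomology_map f n h).
Proof.
by move=> [y <- <-]; exists (cocycle_map f y) => //; rewrite -cohomology_map_class.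
Qed.

(** By linearity injectivity may be tested on the kernel, and both halves of bijectivity can then be
    phrased with representatives only. *)
Lemma quasi_isoP : quasi_iso f <-> forall n,
  (forall (x : C n) h, represents x h -> represents (f n x) 0 -> h = 0) /\
  (forall k, exists2 x : C n, cdiff C (erefl (n + 1)) x = 0 & represents (f n x) k).
Proof.
split=> [fq n|fP n].
  have [g fK gK] := fq n; split=> [x h xh fx0|k].
    rewrite -[h]fK (represents_fun (represents_map xh) fx0).
    by rewrite -(raddf0 (cohomology_map f n)) fK.
  have [x xg] := represents_ex (g k); exists x; first exact: represents_cocycle xg.
  by have := represents_map xg; rewrite gK.
have [inj surj] := fP n.
have f_inj : injective (cohomology_map f n).
  move=> h k fhk; apply/eqP; rewrite -subr_eq0; apply/eqP.
  have [x xhk] := represents_ex (h - k); apply: (inj _ _ xhk).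
  by have := represents_map xhk; rewrite linearB fhk subrr.
have f_surj k : exists h, cohomology_map f n h = k.
  have [x /cocycle_represents[h xh] fxk] := surj k; exists h.
  exact: represents_fun (represents_map xh) fxk.
exists (fun k => projT1 (cid (f_surj k))) => k; last by case: cid.
by apply: f_inj; case: cid.
Qed.

End QuasiIso.

Section ZeroDifferentialClass.
Variables (R : pzRingType) (C : cochain R).
Hypothesis C0 : forall n m (nm : n + 1 = m) (x : C n), cdiff C nm x = 0.

Fact zero_diff_cocycle n (x : C n) : x \in @is_cocycle R C n.
Proof. by rewrite inE C0. Qed.

Definition zero_class_fun n (x : C n) : cohomology C n :=
  coclass (Cocycle (zero_diff_cocycle x)).

Fact zero_class_linear n : linear (@zero_class_fun n).
Proof.
move=> c x y; rewrite /zero_class_fun /coclass -linearP.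
by congr (quotmod_pi _ _); exact/val_inj.
Qed.

HB.instance Definition _ n := GRing.isLinear.Build R (C n) (cohomology C n) _
  (@zero_class_fun n) (@zero_class_linear n).

(** The identification of a complex having zero differential with its own cohomology. *)
Definition zero_class n : {linear C n -> cohomology C n} := @zero_class_fun n.

Lemma represents_zero_class n (x : C n) : represents x (zero_class n x).
Proof. by exists (Cocycle (zero_diff_cocycle x)). Qed.

Lemma zero_class_inj n : injective (zero_class n).
Proof. by move=> x y /coclassP[z]; rewrite C0 => /esym/eqP; rewrite subr_eq0 => /eqP. Qed.

Lemma zero_class_surj n (k : cohomology C n) : exists x, zero_class n x = k.
Proof.
have [x xk] := represents_ex k; exists x.
exact: represents_fun (represents_zero_class x) xk.
Qed.

End ZeroDifferentialClass.

(** * Maps from free modules to a stage of a functor *)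

Section Push.
Variables (K : fieldType) (Y : Zcochain K) (n : int).

(** Extending the structure map by zero to [j > i] gives a map for every pair of indices, so that
    sums need not be restricted to [j <= i]. *)
Definition ztrunc (j i : int) : {linear Y j n -> Y i n} :=
  if pselect (j <= i) is left ji then zmap Y ji n else \0.

Lemma ztruncE (j i : int) (ji : j <= i) x : ztrunc j i x = zmap Y ji n x.
Proof.
rewrite /ztrunc; case: pselect => // ji'.
by rewrite (bool_irrelevance ji' ji).
Qed.

Lemma ztrunc_gt (j i : int) x : i < j -> ztrunc j i x = 0.
Proof. by rewrite /ztrunc; case: pselect => // ji; rewrite ltNge ji. Qed.

Lemma ztrunc_id (i : int) x : ztrunc i i x = x.
Proof. by rewrite ztruncE zmap_id. Qed.

Lemma zmap_ztrunc (j i k : int) (ik : i <= k) x : j <= i ->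
  zmap Y ik n (ztrunc j i x) = ztrunc j k x.
Proof.
move=> ji; rewrite !ztruncE; first exact: le_trans ik.
by move=> jk; rewrite (zmap_comp ji ik).
Qed.

Variables (V : int -> lmodType K) (e : int -> int).
Variable psi : forall j, {linear V j -> Y (e j) n}.

(** Stage [i] of the morphism that [psi] induces on the free module whose generators [V j] sit in
    internal degree [e j]. On F0 the degree [e j] is [j], on F1 it is [j + 1]. *)
Definition push (i : int) : {linear dsum V -> Y i n} :=
  dsum_lift (fun j => ztrunc (e j) i \o psi j).

Lemma pushE i (s : seq int) (a : dsum V) :
  uniq s -> (forall j, j \notin s -> dsum_coef j a = 0) ->
  push i a = \sum_(j <- s) ztrunc (e j) i (psi j (dsum_coef j a)).
Proof. exact: dsum_liftE. Qed.

(** The support condition excludes the summands that [ztrunc] kills at stage [i] but may keep at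
    stage [k]. *)
Lemma zmap_push (i k : int) (ik : i <= k) (a : dsum V) :
  (forall j, i < e j -> dsum_coef j a = 0) ->
  zmap Y ik n (push i a) = push k a.
Proof.
move=> ai; have [s as_] := dsum_supp a.
rewrite !(@pushE _ (undup s)) ?undup_uniq // => [|j|j]; rewrite ?mem_undup;
  [|exact: as_|exact: as_].
rewrite raddf_sum; apply: eq_bigr => j _ /=.
have [ej|/ai ->] := leP (e j) i; first exact: zmap_ztrunc.
by rewrite !raddf0.
Qed.

End Push.

Lemma leS (j : int) : j <= j + 1.
Proof. by rewrite lerDl. Qed.

Lemma ztrunc_zmap (K : fieldType) (Y : Zcochain K) n (j k i : int) (jk : j <= k) x :
  k <= i -> ztrunc Y n k i (zmap Y jk n x) = ztrunc Y n j i x.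
Proof.
move=> ki; rewrite !ztruncE; first exact: le_trans ki.
by move=> ji; rewrite -(zmap_comp jk ki).
Qed.

Lemma cdiff_ztrunc (K : fieldType) (Y : Zcochain K) (n m : int) (nm : n + 1 = m)
    (j i : int) x :
  cdiff (Y i) nm (ztrunc Y n j i x) = ztrunc Y m j i (cdiff (Y j) nm x).
Proof.
by rewrite /ztrunc; case: pselect => ji; rewrite ?linear0 // cmap_diff.
Qed.

Lemma seq_int_lb (s : seq int) : exists l, forall i : int, i \in s -> l <= i.
Proof.
elim: s => [|k s [l ls]]; first by exists 0.
exists (Num.min k l) => i; rewrite inE => /predU1P[->|/ls]; lia.
Qed.

(** * Exactness of the resolution F1 -> F0 -> M *)

Section Shift.
Variables (K : fieldType) (M : Zcochain K) (n : int).
Implicit Types (a b : total_obj M n) (i j : int).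

Lemma shift_coef j b :
  dsum_coef j (shift M n b) = zmap M (pred_le j) n (dsum_coef (j - 1) b).
Proof. by []. Qed.

(** The map F1 -> F0 of the resolution, defined on the whole direct sum. *)
Definition shift_sub : {linear total_obj M n -> total_obj M n} :=
  shift M n \- idfun.

Lemma shift_sub_coef j b : dsum_coef j (shift_sub b) =
  zmap M (pred_le j) n (dsum_coef (j - 1) b) - dsum_coef j b.
Proof. by []. Qed.

Lemma shift_coefS j b :
  dsum_coef (j + 1) (shift M n b) = zmap M (leS j) n (dsum_coef j b).
Proof.
rewrite shift_coef; move: (pred_le (j + 1)) (leS j).
have -> : j + 1 - 1 = j by rewrite addrK.
by move=> p q; rewrite (bool_irrelevance p q).
Qed.

(** Reindexing by [j + 1]: the shift moves the [j]-th coefficient into the next summand. *)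
Lemma push_shift (Y : Zcochain K) (m : int)
    (psi : forall j, {linear M j n -> Y j m}) i b :
  push psi i (shift M n b) =
  push (e := +%R^~ 1) (fun j => psi (j + 1) \o zmap M (leS j) n) i b.
Proof.
have [s bs] := dsum_supp b.
have s_uniq := undup_uniq s.
rewrite [RHS](@pushE _ _ _ _ _ _ _ (undup s)) // => [|j]; last first.
  by rewrite mem_undup; exact: bs.
rewrite (@pushE _ _ _ _ _ _ _ [seq j + 1 | j <- undup s]).
- by rewrite big_map; apply: eq_bigr => j _; rewrite shift_coefS.
- by rewrite map_inj_uniq //; exact: addIr.
move=> j js; rewrite shift_coef bs ?linear0 //; apply: contra js => js.
by apply/mapP; exists (j - 1); rewrite ?mem_undup ?subrK.
Qed.

(* [push (fun=> idfun) i] is the augmentation F0 (i) -> M i. *)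
Lemma push_rec i a : push (fun=> idfun) i a =
  zmap M (pred_le i) n (push (fun=> idfun) (i - 1) a) + dsum_coef i a.
Proof.
have [s as_] := dsum_supp a.
have s_supp j : j \notin undup (i :: s) -> dsum_coef j a = 0.
  by rewrite mem_undup inE negb_or => /andP[_ /as_].
rewrite !(@pushE _ _ _ _ _ _ _ (undup (i :: s))) ?undup_uniq //.
rewrite !(bigD1_seq i) ?mem_undup ?mem_head ?undup_uniq //=.
rewrite ztrunc_id ztrunc_gt; last by lia.
rewrite add0r addrC linear_sum; congr (_ + _); apply: eq_bigr => j ji.
have [ij|ij] := leP j (i - 1); first by rewrite zmap_ztrunc.
by rewrite !ztrunc_gt ?linear0 //; lia.
Qed.

Lemma push_below a : exists l, forall i, i < l -> push (fun=> idfun) i a = 0.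
Proof.
have [s as_] := dsum_supp a.
have [l ls] := seq_int_lb s.
exists l => i il; rewrite (@pushE _ _ _ _ _ _ _ (undup s)) ?undup_uniq //.
  rewrite big_seq big1 // => j; rewrite mem_undup => /ls lj.
  by rewrite ztrunc_gt //; lia.
by move=> j; rewrite mem_undup; exact: as_.
Qed.

(** Each coefficient of such a [b] is the image of the preceding one, and far enough down they
    vanish by finiteness of the support. *)
Lemma shift_sub_inj b : shift_sub b = 0 -> b = 0.
Proof.
move=> /eqP; rewrite [shift_sub b]/= subr_eq0 => /eqP sb.
have b0 k : forall j, dsum_coef (j - k%:Z) b = 0 -> dsum_coef j b = 0.
  elim: k => [|k IHk] j; first by rewrite subr0.
  move=> bj; rewrite -sb shift_coef IHk ?linear0 //.
  by have -> : j - 1 - k%:Z = j - k.+1%:Z by lia.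
have [s bs] := dsum_supp b; apply: dsumP => j; rewrite linear0.
have [k ks] : exists k : nat, j - k%:Z \notin s.
  have [l ls] := seq_int_lb s; exists (absz (j - l + 1)).
  by apply/negP => /ls; lia.
by apply: (b0 k); exact: bs.
Qed.

(** The equations for the coefficients of [b] are solved upwards from below the support of [a]; the
    vanishing of the augmentation at stage [i] lets the solution stop there. *)
Lemma shift_sub_exact i a : (forall j, i < j -> dsum_coef j a = 0) ->
  push (fun=> idfun) i a = 0 ->
  exists2 b, (forall j, i <= j -> dsum_coef j b = 0) & shift_sub b = a.
Proof.
move=> ai pa.
have [l al] := push_below a.
(* By [push_rec], minus the partial augmentations solve the recursion below [i]. At [j = i] the
   equation is the hypothesis [pa]. *)
pose b j : M j n := if j < i then - push (fun=> idfun) j a else 0.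
have bs : exists s : seq int, forall j, j \notin s -> b j = 0.
  exists [seq l + k%:Z | k <- iota 0 (absz (i - l))] => j js; rewrite /b.
  case: ifP => // ji; rewrite al ?oppr0 // ltNge; apply: contra js => lj.
  apply/mapP; exists (absz (j - l)); last by lia.
  by rewrite mem_iota; lia.
exists (mk_dsum bs) => [j ij|]; first by rewrite /dsum_coef /= /b ltNge ij.
apply: dsumP => j; rewrite shift_sub_coef /dsum_coef /= /b.
have [ji|ij] := ltP j i.
  have -> : j - 1 < i by lia.
  by rewrite (push_rec j) linearN opprK /= addKr.
rewrite subr0; have [ji|ji] := ltP (j - 1) i; last first.
  by rewrite linear0; apply/esym/ai; lia.
have <- : i = j by lia.
by move: pa; rewrite push_rec linearN => /eqP; rewrite addrC addr_eq0 => /eqP.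
Qed.

End Shift.

(** * The telescope: the complex built from F0 and F1, and maps out of it *)

Section Telescope.
Variables (K : fieldType) (M : Zcochain K).

Section Object.
Variables (i n : int).

(* F0 (i)^n + F1 (i)^(n+1), both summands sitting inside [total_obj M] so that the
   structure maps of the telescope are inclusions. *)
Definition telescope_pred : {pred total_obj M n * total_obj M (n + 1)} :=
  [pred q | `[< (forall j : int, i < j -> dsum_coef j q.1 = 0) /\
                (forall j : int, i <= j -> dsum_coef j q.2 = 0) >]].

Fact telescope_submod_closed : submod_closed telescope_pred.
Proof.
split=> [|c p q]; rewrite !inE.
  by split=> j _; rewrite linear0.
move=> [p1 p2] [q1 q2].
split=> j ij; rewrite !linearP /=.
  by rewrite p1 // q1 // scaler0 addr0.
by rewrite p2 // q2 // scaler0 addr0.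
Qed.

HB.instance Definition _ := GRing.isSubmodClosed.Build K
  (total_obj M n * total_obj M (n + 1))%type telescope_pred
  telescope_submod_closed.

Record telescope_obj := TelescopeObj {
  telescope_val : total_obj M n * total_obj M (n + 1);
  _ : telescope_val \in telescope_pred
}.

HB.instance Definition _ := [isSub for telescope_val].
HB.instance Definition _ := [Choice of telescope_obj by <:].
HB.instance Definition _ := [SubChoice_isSubLmodule of telescope_obj by <:].

Fact telescope_val_linear : linear telescope_val.
Proof. by []. Qed.

HB.instance Definition _ := GRing.isLinear.Build K telescope_obj
  (total_obj M n * total_obj M (n + 1))%type _ telescope_val telescope_val_linear.

Definition mk_telescope (a : total_obj M n) (b : total_obj M (n + 1))
    (ai : forall j : int, i < j -> dsum_coef j a = 0)
    (bi : forall j : int, i <= j -> dsum_coef j b = 0) : telescope_obj :=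
  @TelescopeObj (a, b) (introT (asboolP _) (conj ai bi)).

Definition tele0 : {linear telescope_obj -> total_obj M n} :=
  fst \o telescope_val.

Definition tele1 : {linear telescope_obj -> total_obj M (n + 1)} :=
  snd \o telescope_val.

Lemma telescopeP (p q : telescope_obj) :
  tele0 p = tele0 q -> tele1 p = tele1 q -> p = q.
Proof. by move: p q => [[a b] ab] [[c d] cd] /= E F; apply/val_inj; congr pair. Qed.

Lemma tele0_supp q (j : int) : i < j -> dsum_coef j (tele0 q) = 0.
Proof. by case: q => q /= /asboolP[+ _]; exact. Qed.

Lemma tele1_supp q (j : int) : i <= j -> dsum_coef j (tele1 q) = 0.
Proof. by case: q => q /= /asboolP[_ +]; exact. Qed.

End Object.

Arguments tele0 {i n}.
Arguments tele1 {i n}.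

(** The F1 part of an element of degree [n] lives in degree [n + 1], while differentials are indexed
    by a target [m]; this transports between the two. *)
Definition total_cast (n m : int) (nm : n + 1 = m) :
    {linear total_obj M (n + 1) -> total_obj M m} :=
  match nm in _ = m return {linear total_obj M (n + 1) -> total_obj M m} with
  | erefl => idfun end.

Section Differential.
Variables (i n m : int) (nm : n + 1 = m).

(** The shift raises the support by one, from strictly below [i] to at most [i], which is exactly
    the bound for F0. *)
Fact telescope_diff_supp0 (q : telescope_obj i n) (j : int) : i < j ->
  dsum_coef j (shift_sub M m (total_cast nm (tele1 q))) = 0.
Proof.
case: m / nm => ij; rewrite shift_sub_coef /= !tele1_supp ?linear0 ?addr0 //; lia.
Qed.

Definition telescope_diff_fun (q : telescope_obj i n) : telescope_obj i m :=
  @mk_telescope i m _ 0 (telescope_diff_supp0 q) (fun _ _ => erefl).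

Fact telescope_diff_linear : linear telescope_diff_fun.
Proof.
move=> c p q; apply: telescopeP; rewrite [RHS]linearP /=; last first.
  by rewrite scaler0 addr0.
exact: (linearP (shift_sub M m \o total_cast nm \o tele1)).
Qed.

HB.instance Definition _ := GRing.isLinear.Build K (telescope_obj i n)
  (telescope_obj i m) _ telescope_diff_fun telescope_diff_linear.

Definition telescope_diff : {linear telescope_obj i n -> telescope_obj i m} :=
  telescope_diff_fun.

End Differential.

Fact telescope_diffK i (n m p : int) (nm : n + 1 = m) (mp : m + 1 = p)
  (x : telescope_obj i n) : telescope_diff i mp (telescope_diff i nm x) = 0.
Proof.
apply: telescopeP; rewrite [RHS]linear0 //.
exact: (linear0 (shift_sub M p \o total_cast mp)).
Qed.

Definition telescope_cochain i : cochain K := Cochain (@telescope_diffK i).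

(** The differential is F1 -> F0, which is injective. *)
Lemma telescope_cocycle i n (q : telescope_cochain i n) :
  cdiff (telescope_cochain i) (erefl (n + 1)) q = 0 -> tele1 q = 0.
Proof. by move=> /(congr1 tele0); exact: shift_sub_inj. Qed.

Section Structure.
Variables (i j : int) (ij : i <= j).

Section Degree.
Variable n : int.

Fact telescope_map_supp0 (q : telescope_obj i n) (k : int) : j < k ->
  dsum_coef k (tele0 q) = 0.
Proof. by move=> jk; apply: tele0_supp; exact: le_lt_trans jk. Qed.

Fact telescope_map_supp1 (q : telescope_obj i n) (k : int) : j <= k ->
  dsum_coef k (tele1 q) = 0.
Proof. by move=> jk; apply: tele1_supp; exact: le_trans jk. Qed.

Definition telescope_map_fun (q : telescope_obj i n) : telescope_obj j n :=
  mk_telescope (telescope_map_supp0 q) (telescope_map_supp1 q).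

Fact telescope_map_linear : linear telescope_map_fun.
Proof. by move=> c p q; apply: telescopeP. Qed.

HB.instance Definition _ := GRing.isLinear.Build K (telescope_obj i n)
  (telescope_obj j n) _ telescope_map_fun telescope_map_linear.

End Degree.

Fact telescope_map_diff n m (nm : n + 1 = m) (q : telescope_cochain i n) :
  telescope_map_fun (cdiff (telescope_cochain i) nm q) =
  cdiff (telescope_cochain j) nm (telescope_map_fun q).
Proof. exact: telescopeP. Qed.

Definition telescope_map : cochain_map (telescope_cochain i) (telescope_cochain j) :=
  @CochainMap K (telescope_cochain i) (telescope_cochain j)
    telescope_map_fun telescope_map_diff.

End Structure.

Fact telescope_map_id (i : int) (ii : i <= i) n (x : telescope_cochain i n) :
  telescope_map ii n x = x.
Proof. exact: telescopeP. Qed.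

Fact telescope_map_comp (i j k : int) (ij : i <= j) (jk : j <= k) (ik : i <= k)
    n (x : telescope_cochain i n) :
  telescope_map ik n x = telescope_map jk n (telescope_map ij n x).
Proof. exact: telescopeP. Qed.

Definition telescope : Zcochain K := ZCochain telescope_map_id telescope_map_comp.

Section Map.
Variable Y : Zcochain K.
Variables (sigma : forall n j, {linear M j n -> Y j n})
  (tau : forall n j, {linear M j (n + 1) -> Y (j + 1) n}).
Hypothesis sigma_diff : forall n m (nm : n + 1 = m) j h,
  cdiff (Y j) nm (sigma n j h) = 0.
Hypothesis tau_diff : forall n j h,
  cdiff (Y (j + 1)) (erefl (n + 1)) (tau n j h) =
  sigma (n + 1) (j + 1) (zmap M (leS j) (n + 1) h) -
  zmap Y (leS j) (n + 1) (sigma (n + 1) j h).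

(** [sigma] gives the images of the generators of F0, and [tau] those of F1. The latter are
    homotopies correcting the failure of [sigma] to commute with [t]. *)
Definition of_telescope_fun i n (q : telescope i n) : Y i n :=
  push (sigma n) i (tele0 q) + push (e := +%R^~ 1) (tau n) i (tele1 q).

Fact of_telescope_linear i n : linear (@of_telescope_fun i n).
Proof. by move=> c p q; rewrite /of_telescope_fun !linearP scalerDr addrACA. Qed.

HB.instance Definition _ i n := GRing.isLinear.Build K (telescope i n) (Y i n) _
  (@of_telescope_fun i n) (@of_telescope_linear i n).

Lemma cdiff_push_sigma i n m (nm : n + 1 = m) (a : total_obj M n) :
  cdiff (Y i) nm (push (sigma n) i a) = 0.
Proof.
have [s as_] := dsum_supp a.
rewrite (@pushE _ _ _ _ _ _ _ (undup s)) ?undup_uniq // => [|j]; last first.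
  by rewrite mem_undup; exact: as_.
rewrite linear_sum big1 // => j _ /=.
by rewrite cdiff_ztrunc sigma_diff linear0.
Qed.

Lemma cdiff_push_tau i n (b : total_obj M (n + 1)) :
  (forall j : int, i <= j -> dsum_coef j b = 0) ->
  cdiff (Y i) (erefl (n + 1)) (push (e := +%R^~ 1) (tau n) i b) =
  push (sigma (n + 1)) i (shift_sub M (n + 1) b).
Proof.
move=> bi; have [s bs] := dsum_supp b; rewrite [RHS]linearB push_shift.
rewrite !(@pushE _ _ _ _ _ _ _ (undup s)) ?undup_uniq //;
  try by move=> j; rewrite mem_undup; exact: bs.
rewrite linear_sum -sumrB; apply: eq_bigr => j _ /=.
(* For [j < i] both [j] and [j + 1] are at most [i], so no truncation interferes and [tau_diff]
   applies summand by summand. *)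
have [ij|ji] := leP i j; first by rewrite bi // !linear0 addr0.
rewrite cdiff_ztrunc tau_diff linearB; congr (_ - _).
by rewrite ztrunc_zmap //; lia.
Qed.

Fact of_telescope_diff i n m (nm : n + 1 = m) (q : telescope i n) :
  of_telescope_fun (cdiff (telescope i) nm q) = cdiff (Y i) nm (of_telescope_fun q).
Proof.
case: m / nm; rewrite /of_telescope_fun linear0 addr0.
rewrite [RHS](linearD (cdiff (Y i) _)) cdiff_push_sigma.
by rewrite add0r cdiff_push_tau // => j; exact: tele1_supp.
Qed.

Fact of_telescope_nat i j (ij : i <= j) n (q : telescope i n) :
  of_telescope_fun (zmap telescope ij n q) = zmap Y ij n (of_telescope_fun q).
Proof.
rewrite /of_telescope_fun linearD !zmap_push // => k ik.
  by apply: tele1_supp; lia.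
exact: tele0_supp.
Qed.

Definition of_telescope : Zcochain_map telescope Y :=
  @ZCochainMap K telescope Y
    (fun i => @CochainMap K (telescope i) (Y i) (@of_telescope_fun i)
      (@of_telescope_diff i))
    of_telescope_nat.

Lemma telescope_exact i m n (mn : m + 1 = n) (q : telescope i n) :
  tele1 q = 0 -> push (fun=> idfun) i (tele0 q) = 0 ->
  exists z : telescope i m, cdiff (telescope i) mn z = q.
Proof.
move=> q1 /shift_sub_exact[j ij|b bi bq]; first exact: tele0_supp.
case: n / mn q q1 b bi bq => q q1 b bi bq.
exists (@mk_telescope i m 0 b (fun _ _ => erefl) bi).
exact: telescopeP.
Qed.

Lemma push_surj i n (h : M i n) : exists2 a : total_obj M n,
  (forall j, i < j -> dsum_coef j a = 0) & push (fun=> idfun) i a = h.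
Proof.
(* The witness is [h] placed in the [i]-th summand; [ztrunc M n i j h] is [h] when [j = i] and gives
   it the type [M j n] without a transport. *)
have hP : exists s : seq int, forall j, j \notin s ->
    (if j == i then ztrunc M n i j h else 0) = 0.
  by exists [:: i] => j; rewrite inE => /negPf ->.
exists (mk_dsum hP) => [j ij|]; first by rewrite /dsum_coef /= gt_eqF.
rewrite (@pushE _ _ _ _ _ _ _ [:: i]) // => [|j].
  by rewrite big_seq1 ztrunc_id /dsum_coef /= eqxx ztrunc_id.
by rewrite inE /dsum_coef /= => /negPf ->.
Qed.

Variable theta : forall i n, {linear M i n -> cohomology (Y i) n}.
Hypothesis theta_inj : forall i n, injective (theta i n).
Hypothesis theta_surj : forall i n k, exists h, theta i n h = k.
Hypothesis theta_nat : forall i j (ij : i <= j) n h,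
  theta j n (zmap M ij n h) = cohomology_map (zmap Y ij) n (theta i n h).
Hypothesis sigma_theta : forall n j h, represents (sigma n j h) (theta j n h).

(** On cohomology [of_telescope] is thus the augmentation followed by [theta]; this is checked on
    each summand by naturality of [theta]. *)
Lemma represents_push_sigma i n (a : total_obj M n) :
  represents (push (sigma n) i a) (theta i n (push (fun=> idfun) i a)).
Proof.
have [s as_] := dsum_supp a.
have us_ j : j \notin undup s -> dsum_coef j a = 0.
  by rewrite mem_undup; exact: as_.
rewrite !(@pushE _ _ _ _ _ _ _ (undup s)) ?undup_uniq // linear_sum.
elim/big_rec2: _ => [|j x h _]; first exact: represents0.
apply: representsD; have [ji|ij] := leP j i.
  by rewrite !ztruncE /= theta_nat; exact/represents_map/sigma_theta.
by rewrite !ztrunc_gt // linear0; exact: represents0.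
Qed.

(** Cocycles have only an F0 part. If the image class is zero, injectivity of [theta] makes the
    augmentation vanish and [telescope_exact] yields a primitive. Surjectivity combines those of
    [theta] and of the augmentation. *)
Lemma of_telescope_quasi_iso : Zquasi_iso of_telescope.
Proof.
move=> i; apply/quasi_isoP => n; split=> [q h qh fq0|k].
  have q1 : tele1 q = 0 by apply: telescope_cocycle; exact: represents_cocycle qh.
  apply/(represents_eq0 (subrK 1 n) qh)/telescope_exact => //.
  apply: (@theta_inj i n); rewrite linear0.
  apply: represents_fun (represents_push_sigma _ _) _.
  by move: fq0; rewrite /= /of_telescope_fun q1 linear0 addr0.
have [h <-] := theta_surj k; have [a ai <-] := push_surj h.
exists (@mk_telescope i n a 0 ai (fun _ _ => erefl)).
  apply: telescopeP; rewrite [RHS]linear0 //.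
  exact: (linear0 (shift_sub M (n + 1))).
by rewrite /= /of_telescope_fun linear0 addr0; exact: represents_push_sigma.
Qed.

End Map.
End Telescope.

(** * Passage from functors to differential bigraded modules *)

Section DbgMap.
Variables (K : fieldType) (X Y : Zcochain K) (F : Zcochain_map X Y).

Section TotalMap.
Variable n : int.

Fact total_map_supp (x : total_obj X n) : exists s : seq int,
  forall i, i \notin s -> F i n (dsum_coef i x) = 0.
Proof. by have [s xs] := dsum_supp x; exists s => i /xs ->; rewrite linear0. Qed.

Definition total_map_fun (x : total_obj X n) : total_obj Y n :=
  mk_dsum (total_map_supp x).

Fact total_map_linear : linear total_map_fun.
Proof.
by move=> c x y; apply: dsumP => i; exact: (linearP (F i n) c (dsum_coef i x)).
Qed.

HB.instance Definition _ := GRing.isLinear.Build K (total_obj X n) (total_obj Y n)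
  _ total_map_fun total_map_linear.

Definition total_map : {linear total_obj X n -> total_obj Y n} := total_map_fun.

Fact total_map_shift x : total_map (shift X n x) = shift Y n (total_map x).
Proof. by apply: dsumP => i; exact: ztrans_nat. Qed.

Definition dbg_total_map : {linear dbg_obj X n -> dbg_obj Y n} :=
  polymod_map total_map_shift.

End TotalMap.

Fact dbg_total_map_diff n m (nm : n + 1 = m) (x : dbg_of X n) :
  dbg_total_map m (cdiff (dbg_of X) nm x) = cdiff (dbg_of Y) nm (dbg_total_map n x).
Proof. by apply: dsumP => i; exact: cmap_diff. Qed.

Fact dbg_total_map_comp n i (x : dbg_of X n) : gcomp (dbg_grading (dbg_of X) n) i x ->
  gcomp (dbg_grading (dbg_of Y) n) i (dbg_total_map n x).
Proof.
move=> xi j ji.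
transitivity (F j n (dsum_coef j (x : total_obj X n))) => //.
by rewrite (xi _ ji) linear0.
Qed.

Definition dbg_of_map : dbg_map (dbg_of X) (dbg_of Y) :=
  @DbgMap K (dbg_of X) (dbg_of Y)
    (@CochainMap _ (dbg_of X) (dbg_of Y) dbg_total_map dbg_total_map_diff)
    dbg_total_map_comp.

Local Notation coef i x := (dsum_coef i (x : total_obj _ _)).

Lemma dbg_of_diff_coef (Z : Zcochain K) n m (nm : n + 1 = m) (x : dbg_of Z n) i :
  coef i (cdiff (dbg_of Z) nm x) = cdiff (Z i) nm (coef i x).
Proof. by []. Qed.

Lemma dbg_of_map_coef n (x : dbg_of X n) i :
  coef i (dbg_of_map n x) = F i n (coef i x).
Proof. by []. Qed.

(** Differentials and maps act on each internal degree separately, so primitives and preimages are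
    chosen there and assembled by [dsum_choice]. *)
Lemma dbg_of_quasi_iso : Zquasi_iso F -> dbg_quasi_iso dbg_of_map.
Proof.
move=> Fq; apply/quasi_isoP => n; split=> [x h xh Fx0|k].
  apply/(represents_eq0 (subrK 1 n) xh).
  have [y dy] := (represents_eq0 (subrK 1 n) Fx0).2 erefl.
  have [s xs] := dsum_supp (x : total_obj X n).
  have [i|i /xs ->|z zP] := @dsum_choice _ _ (fun i => X i (n - 1))
      (fun i z => cdiff (X i) (subrK 1 n) z = coef i x) s.
  - have /cocycle_represents[hi xhi] :
        cdiff (X i) (erefl (n + 1)) (coef i x) = 0.
      by rewrite -dbg_of_diff_coef (represents_cocycle _ xh).
    apply/(represents_eq0 _ xhi); apply: ((quasi_isoP (F i)).1 (Fq i) n).1 xhi _.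
    by rewrite -dbg_of_map_coef -dy dbg_of_diff_coef; exact: represents_diff.
  - by rewrite linear0.
  - by exists z; apply: dsumP.
have [y yk] := represents_ex k.
have [s ys] := dsum_supp (y : total_obj Y n).
have [i|i /ys ->|x xP] := @dsum_choice _ _ (fun i => X i n)
    (fun i x => cdiff (X i) (erefl (n + 1)) x = 0 /\
      exists w, cdiff (Y i) (subrK 1 n) w = F i n x - coef i y) s.
- have /cocycle_represents[ki yki] :
      cdiff (Y i) (erefl (n + 1)) (coef i y) = 0.
    by rewrite -dbg_of_diff_coef (represents_cocycle _ yk).
  have [x dx xki] := ((quasi_isoP (F i)).1 (Fq i) n).2 ki.
  by exists x; split=> //; exact: represents_eq xki yki.
- by split; [|exists 0]; rewrite !linear0 ?addr0.
have [r xr] := dsum_supp x.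
(* The primitives must be chosen again, as those from the previous step were not tied to a finite
   support; outside [s ++ r] both [x] and [y] vanish and 0 will do. *)
have [i|i|w wP] := @dsum_choice _ _ (fun i => Y i (n - 1)) (fun i w =>
    cdiff (Y i) (subrK 1 n) w = F i n (dsum_coef i x) - coef i y) (s ++ r).
- by have [] := xP i.
- by rewrite mem_cat negb_or => /andP[/ys -> /xr ->]; rewrite !linear0 addr0.
exists x; first by apply: (@dsumP _ _ _ _ 0) => i; have [] := xP i.
have -> : dbg_of_map n x = cdiff (dbg_of Y) (subrK 1 n) w + y.
  apply: dsumP => i; transitivity (cdiff (Y i) (subrK 1 n) (dsum_coef i w) + coef i y) => //.
  by rewrite wP subrK.
by rewrite -[k]add0r; apply: representsD yk; exact: represents_diff.
Qed.

End DbgMap.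

(** * The two quasi-isomorphisms out of the telescope, and formality *)

Lemma telescope_augmentation (K : fieldType) (M : Zcochain K) :
  (forall i n m (nm : n + 1 = m) (x : M i n), cdiff (M i) nm x = 0) ->
  exists g : Zcochain_map (telescope M) M, Zquasi_iso g.
Proof.
move=> M0.
(* The identity commutes strictly with the structure maps, so the homotopy [tau] can be 0; the
   resulting map is the augmentation on F0 and zero on F1. *)
pose sigma n j : {linear M j n -> M j n} := idfun.
pose tau n j : {linear M j (n + 1) -> M (j + 1) n} := \0.
have tauP n j h : cdiff (M (j + 1)) (erefl (n + 1)) (tau n j h) =
    sigma (n + 1) (j + 1) (zmap M (leS j) (n + 1) h) -
    zmap M (leS j) (n + 1) (sigma (n + 1) j h).
  by rewrite M0 subrr.
exists (@of_telescope K M M sigma tau (fun n m nm j => M0 j n m nm) tauP).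
apply: (@of_telescope_quasi_iso _ _ _ _ _ _ _ (fun i n => zero_class (M0 i) n)).
- by move=> i n; exact: zero_class_inj.
- by move=> i n; exact: zero_class_surj.
- move=> i j ij n h.
  apply: represents_fun (represents_zero_class _ _) _.
  exact/represents_map/represents_zero_class.
- by move=> n j h; exact: represents_zero_class.
Qed.

Section Formality.
Variables (K : fieldType) (X : Zcochain K).

(** Over a field the surjection from cocycles to classes splits linearly: lift the identity along
    it. *)
Lemma cocycle_section n j : exists sigma : {linear cohomology (X j) n -> X j n},
  forall h, represents (sigma h) h.
Proof.
pose cl : {linear cocycle (X j) n -> cohomology (X j) n} :=
  quotmod_pi (@is_coboundary_submod_closed K (X j) n).
have [|s sP] := @linear_lift _ _ _ cl _ idfun.
  by move=> h; have [y ->] := coclass_surj h; exists y.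
by exists (val \o s) => h; exists (s h) => //; exact: sP.
Qed.

Lemma telescope_quasi_iso :
  exists f : Zcochain_map (telescope (Zcohomology X)) X, Zquasi_iso f.
Proof.
pose H := Zcohomology X.
pose sigma n j : {linear H j n -> X j n} := projT1 (cid (cocycle_section n j)).
have sigmaP n j h : represents (sigma n j h) h.
  by rewrite /sigma; case: cid => s /= sP.
have sigma_diff n m (nm : n + 1 = m) j h : cdiff (X j) nm (sigma n j h) = 0.
  exact: represents_cocycle (sigmaP _ _ _).
(* Both terms on the right represent the image of [h] under the structure map, so their difference
   is a coboundary; [linear_lift] along the differential makes the primitive linear in [h]. *)
have tau_ex n j : exists tau : {linear H j (n + 1) -> X (j + 1) n},
    forall h, cdiff (X (j + 1)) (erefl (n + 1)) (tau h) =
      sigma (n + 1) (j + 1) (zmap H (leS j) (n + 1) h) -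
      zmap X (leS j) (n + 1) (sigma (n + 1) j h).
  apply: (@linear_lift _ _ _ (cdiff (X (j + 1)) (erefl (n + 1))) _
    ((sigma (n + 1) (j + 1) \o zmap H (leS j) (n + 1)) \-
     (zmap X (leS j) (n + 1) \o sigma (n + 1) j))) => h.
  apply: represents_eq (sigmaP _ _ _) _.
  exact: represents_map.
pose tau n j := projT1 (cid (tau_ex n j)).
have tauP n j h : cdiff (X (j + 1)) (erefl (n + 1)) (tau n j h) =
    sigma (n + 1) (j + 1) (zmap H (leS j) (n + 1) h) -
    zmap X (leS j) (n + 1) (sigma (n + 1) j h).
  by rewrite /tau; case: cid => t /= tP.
exists (@of_telescope K H X sigma tau sigma_diff tauP).
(* [H i n] is the cohomology of [X i] by definition, so the required natural isomorphism is the
   identity. *)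
pose theta i n : {linear H i n -> cohomology (X i) n} := idfun.
apply: (@of_telescope_quasi_iso K H X sigma tau sigma_diff tauP theta) => //.
  by move=> i n x y.
by move=> i n k; exists k.
Qed.

End Formality.

Theorem lemma3p9 (K : fieldType) (X : Zcochain K) :
  (exists (Q : dbgmod K) (f : dbg_map Q (dbg_of X))
          (g : dbg_map Q (dbg_of (Zcohomology X))),
     dbg_quasi_iso f /\ dbg_quasi_iso g) /\
  Zweq X (Zcohomology X).
Proof.
have [f fq] := telescope_quasi_iso X.
have [|g gq] := @telescope_augmentation K (Zcohomology X); first by [].
split.
  exists (dbg_of (telescope (Zcohomology X))), (dbg_of_map f), (dbg_of_map g).
  by split; exact: dbg_of_quasi_iso.
apply: (@rst_trans _ _ _ (telescope (Zcohomology X))).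
  by apply: rst_sym; apply: rst_step; exists f.
by apply: rst_step; exists g.
Qed.
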